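(* Let $\mathcal{A}$ be an associative conformal algebra, $M$ a conformal $\mathcal{A}$-bimodule, $\varphi_\lambda$ a $2$-cocycle in $C^2(\mathcal{A},M)$, and $T:M\to\mathcal{A}$ a $\varphi$-Rota-Baxter operator. Then $M$ becomes a conformal NS-algebra under the three $\lambda$-multiplications $$m\succ_\lambda n=T(m)_\lambda n,\qquad m\prec_\lambda n=m_\lambda T(n),\qquad m\vee_\lambda n=\varphi_\lambda(T(m),T(n)),\qquad m,n\in M.$$
   Context: All vector spaces are over $\mathbb{C}$. For $\mathbb{C}[\partial]$-modules $U,V,W$, a $\mathbb{C}$-bilinear map $U\times V\to W[\lambda]$, $(u,v)\mapsto u_\lambda v$, is conformal sesquilinear if $(\partial u)_\lambda v=-\lambda\, u_\lambda v$ and $u_\lambda(\partial v)=(\partial+\lambda)(u_\lambda v)$. Maps are extended coefficientwise to polynomials in $\lambda,\mu$. An associative conformal algebra is a $\mathbb{C}[\partial]$-module $\mathcal{A}$ with a conformal sesquilinear map $\mathcal{A}\times\mathcal{A}\to\mathcal{A}[\lambda]$, $(a,b)\mapsto a_\lambda b$, with $(a_\lambda b)_{\lambda+\mu}c=a_\lambda(b_\mu c)$. A conformal $\mathcal{A}$-bimodule is a $\mathbb{C}[\partial]$-module $M$ with conformal sesquilinear maps $\mathcal{A}\times M\to M[\lambda]$, $(a,m)\mapsto a_\lambda m$, and $M\times\mathcal{A}\to M[\lambda]$, $(m,a)\mapsto m_\lambda a$, such that $(a_\lambda b)_{\lambda+\mu}m=a_\lambda(b_\mu m)$, $(m_\lambda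 a)_{\lambda+\mu}b=m_\lambda(a_\mu b)$, $(a_\lambda m)_{\lambda+\mu}b=a_\lambda(m_\mu b)$. $C^2(\mathcal{A},M)$ is the space of conformal sesquilinear maps $\varphi_\lambda:\mathcal{A}\times\mathcal{A}\to M[\lambda]$; $\varphi$ is a $2$-cocycle if $a_\lambda\varphi_\mu(b,c)-\varphi_{\lambda+\mu}(a_\lambda b,c)+\varphi_\lambda(a,b_\mu c)-\varphi_\lambda(a,b)_{\lambda+\mu}c=0$ for all $a,b,c\in\mathcal{A}$. A $\varphi$-Rota-Baxter operator (twisted Rota-Baxter operator) is a $\mathbb{C}[\partial]$-module homomorphism $T:M\to\mathcal{A}$ with $T(m)_\lambda T(n)=T\big(T(m)_\lambda n+m_\lambda T(n)+\varphi_\lambda(T(m),T(n))\big)$ for all $m,n\in M$. A conformal NS-algebra is a $\mathbb{C}[\partial]$-module $\mathcal{N}$ with three conformal sesquilinear maps $\succ_\lambda,\prec_\lambda,\vee_\lambda:\mathcal{N}\times\mathcal{N}\to\mathcal{N}[\lambda]$ such that, with $x\times_\lambda y:=x\succ_\lambda y+x\prec_\lambda y+x\vee_\lambda y$, for all $x,y,z\in\mathcal{N}$: $x\succ_\lambda(y\succ_\mu z)=(x\times_\lambda y)\succ_{\lambda+\mu}z$; $x\prec_\lambda(y\times_\mu z)=(x\prec_\lambda y)\prec_{\lambda+\mu}z$; $x\succ_\lambda(y\prec_\mu z)=(x\succ_\lambda y)\prec_{\lambda+\mu}z$; $x\succ_\lambda(y\vee_\mu z)-(x\times_\lambda y)\vee_{\lambda+\mu}z=(x\vee_\lambda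 y)\prec_{\lambda+\mu}z-x\vee_\lambda(y\times_\mu z)$. *)

(* Defs.v *)
From mathcomp Require Import all_boot all_order all_algebra finmap monalg.
From mathcomp Require Import reals complex.

Set Implicit Arguments.
Unset Strict Implicit.
Unset Printing Implicit Defensive.

Import GRing.Theory.
Local Open Scope ring_scope.

(* A K[\partial]-module is an [lmodType {poly K}]: the indeterminate 'X acts
   as \partial, and the scalar c : K acts as c%:P. *)

(* W[lambda], with p@_n the coefficient of lambda^n. *)
Notation lpoly W := {malg W[nat]}.

(* W[lambda, mu], with p@_(i, j) the coefficient of lambda^i mu^j. *)
Notation lmpoly W := {malg W[(nat * nat)%type]}.

Section LambdaPolynomials.
Variables U V W : zmodType.

(* For additive f; a term whose coefficient vanishes contributes 0. *)
Definition coefmap (f : U -> V) (p : lpoly U) : lpoly V :=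
  \sum_(i <- msupp p) << f p@_i *g i >>.

Definition mul_lambda (p : lpoly W) : lpoly W :=
  \sum_(i <- msupp p) << p@_i *g i.+1 >>.

(* In the next two definitions [op u v] stands for u_lambda v. *)

(* u_lambda (q(mu)), where q(mu) = \sum_j q_j mu^j *)
Definition lambda_mu (op : U -> V -> lpoly W) (u : U) (q : lpoly V) :
    lmpoly W :=
  \sum_(j <- msupp q) \sum_(i <- msupp (op u q@_j))
    << (op u q@_j)@_i *g (i, j) >>.

(* (p(lambda))_(lambda+mu) v, where p(lambda) = \sum_i p_i lambda^i, and
   (lambda+mu)^n is expanded by the binomial formula *)
Definition lambda_plus_mu (op : U -> V -> lpoly W) (p : lpoly U) (v : V) :
    lmpoly W :=
  \sum_(i <- msupp p) \sum_(n <- msupp (op p@_i v)) \sum_(k < n.+1)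
    << (op p@_i v)@_n *+ 'C(n, k) *g ((i + k)%N, (n - k)%N) >>.

End LambdaPolynomials.

Section ConformalStructures.
Variable K : fieldType.

(* The first four fields express K-bilinearity. *)
Record conformal_sesquilinear (U V W : lmodType {poly K})
    (op : U -> V -> lpoly W) : Prop := {
  csesq_addl : forall u u' v, op (u + u') v = op u v + op u' v;
  csesq_addr : forall u v v', op u (v + v') = op u v + op u v';
  csesq_scalel : forall (c : K) u v,
    op (c%:P *: u) v = coefmap ( *:%R c%:P) (op u v);
  csesq_scaler : forall (c : K) u v,
    op u (c%:P *: v) = coefmap ( *:%R c%:P) (op u v);
  csesq_derl : forall u v, op ('X *: u) v = - mul_lambda (op u v);
  csesq_derr : forall u v,
    op u ('X *: v) = coefmap ( *:%R 'X) (op u v) + mul_lambda (op u v)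
}.

Record assoc_conformal (A : lmodType {poly K}) (mul : A -> A -> lpoly A) :
    Prop := {
  aconf_sesq : conformal_sesquilinear mul;
  aconf_assoc : forall a b c,
    lambda_plus_mu mul (mul a b) c = lambda_mu mul a (mul b c)
}.

Record conformal_bimodule (A M : lmodType {poly K}) (mul : A -> A -> lpoly A)
    (l : A -> M -> lpoly M) (r : M -> A -> lpoly M) : Prop := {
  cbim_sesql : conformal_sesquilinear l;
  cbim_sesqr : conformal_sesquilinear r;
  cbim_left : forall a b m,
    lambda_plus_mu l (mul a b) m = lambda_mu l a (l b m);
  cbim_right : forall m a b,
    lambda_plus_mu r (r m a) b = lambda_mu r m (mul a b);
  cbim_mid : forall a m b,
    lambda_plus_mu r (l a m) b = lambda_mu l a (r m b)
}.

Record conformal_2cocycle (A M : lmodType {poly K}) (mul : A -> A -> lpoly A)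
    (l : A -> M -> lpoly M) (r : M -> A -> lpoly M)
    (phi : A -> A -> lpoly M) : Prop := {
  ccoc_sesq : conformal_sesquilinear phi;
  ccoc_eq : forall a b c,
    lambda_mu l a (phi b c) - lambda_plus_mu phi (mul a b) c
    + lambda_mu phi a (mul b c) - lambda_plus_mu r (phi a b) c = 0
}.

Definition twisted_RotaBaxter (A M : lmodType {poly K})
    (mul : A -> A -> lpoly A) (l : A -> M -> lpoly M) (r : M -> A -> lpoly M)
    (phi : A -> A -> lpoly M) (T : {linear M -> A}) : Prop :=
  forall m n : M,
    mul (T m) (T n) = coefmap T (l (T m) n + r m (T n) + phi (T m) (T n)).

Definition ns_total (N : lmodType {poly K}) (succ prec vee : N -> N -> lpoly N)
    (x y : N) : lpoly N :=
  succ x y + prec x y + vee x y.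

Record conformal_NS (N : lmodType {poly K})
    (succ prec vee : N -> N -> lpoly N) : Prop := {
  ns_sesq_succ : conformal_sesquilinear succ;
  ns_sesq_prec : conformal_sesquilinear prec;
  ns_sesq_vee : conformal_sesquilinear vee;
  ns_succ : forall x y z,
    lambda_mu succ x (succ y z)
    = lambda_plus_mu succ (ns_total succ prec vee x y) z;
  ns_prec : forall x y z,
    lambda_mu prec x (ns_total succ prec vee y z)
    = lambda_plus_mu prec (prec x y) z;
  ns_mid : forall x y z,
    lambda_mu succ x (prec y z) = lambda_plus_mu prec (succ x y) z;
  ns_vee : forall x y z,
    lambda_mu succ x (vee y z)
    - lambda_plus_mu vee (ns_total succ prec vee x y) z
    = lambda_plus_mu prec (vee x y) z
    - lambda_mu vee x (ns_total succ prec vee y z)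
}.

End ConformalStructures.

(* Main.v *)
(** Applying [T] coefficientwise to a polynomial argument of an operation amounts
    to precomposing the operation with [T] in that argument.  The Rota-Baxter
    identity says that [T] maps the total product of [m] and [n] to
    [T(m)_lambda T(n)], so each NS-axiom becomes a bimodule axiom or the cocycle
    equation, evaluated at values of [T]. *)
Require Import Defs.
From mathcomp Require Import all_boot all_order all_algebra finmap monalg.
From mathcomp Require Import reals complex.

Import GRing.Theory.
Local Open Scope ring_scope.

Section Coefmap.
Context {U V : zmodType} {f : U -> V} (f0 : f 0 = 0).

Lemma mcoeff_coefmap (p : lpoly U) (n : nat) : (coefmap f p)@_n = f p@_n.
Proof.
rewrite /coefmap raddf_sum /=.
under eq_bigr do rewrite mcoeffU.
case: (boolP (n \in msupp p)) => [np|np].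
  rewrite (big_fsetD1 n np) /= eqxx big1_fset ?addr0 // => i.
  by rewrite !inE => /andP[/negPf -> _].
rewrite (mcoeff_outdom np) f0 big1_fset // => i ip _.
by case: eqP => // ein; rewrite -ein ip in np.
Qed.

Lemma msupp_coefmap (p : lpoly U) : (msupp (coefmap f p) `<=` msupp p)%fset.
Proof.
apply/fsubsetP => n; rewrite -!mcoeff_neq0 mcoeff_coefmap.
by apply: contraNN => /eqP ->; rewrite f0.
Qed.

(** [f] may kill coefficients, so the support on the left can be strictly smaller; [F 0 n = 0] makes
    the extra terms on the right vanish. *)
Lemma big_msupp_coefmap {X : zmodType} (F : V -> nat -> X) (p : lpoly U) :
    (forall n, F 0 n = 0) ->
  \sum_(n <- msupp (coefmap f p)) F (coefmap f p)@_n n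
  = \sum_(n <- msupp p) F (f p@_n) n.
Proof.
move=> F0; rewrite (big_fset_incl _ (msupp_coefmap p)) => [|n _ nfp].
  by apply: eq_bigr => n _; rewrite mcoeff_coefmap.
by rewrite (mcoeff_outdom nfp).
Qed.

Lemma lambda_mu_coefmap {S W : zmodType} (op : S -> V -> lpoly W) (u : S)
    (q : lpoly U) : op u 0 = 0 ->
  lambda_mu op u (coefmap f q) = lambda_mu (fun s v => op s (f v)) u q.
Proof.
move=> op0.
apply: (big_msupp_coefmap
  (fun v j => \sum_(i <- msupp (op u v)) << (op u v)@_i *g (i, j) >>)) => j.
by rewrite op0 msupp0 big_seq_fset0.
Qed.

Lemma lambda_plus_mu_coefmap {S W : zmodType} (op : V -> S -> lpoly W)
    (p : lpoly U) (v : S) : op 0 v = 0 ->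
  lambda_plus_mu op (coefmap f p) v
  = lambda_plus_mu (fun u s => op (f u) s) p v.
Proof.
move=> op0.
apply: (big_msupp_coefmap
  (fun u i => \sum_(n <- msupp (op u v)) \sum_(k < n.+1)
    << (op u v)@_n *+ 'C(n, k) *g ((i + k)%N, (n - k)%N) >>)) => i.
by rewrite op0 msupp0 big_seq_fset0.
Qed.

End Coefmap.

Section Sesquilinear.
Context {K : fieldType} {U V W : lmodType {poly K}} {op : U -> V -> lpoly W}
  (hop : conformal_sesquilinear op).

Lemma csesq0l v : op 0 v = 0.
Proof. by apply: (addrI (op 0 v)); rewrite -(csesq_addl hop) !addr0. Qed.

Lemma csesq0r u : op u 0 = 0.
Proof. by apply: (addrI (op u 0)); rewrite -(csesq_addr hop) !addr0. Qed.

(** Linearity over [{poly K}] means commuting with both the scalars [c%:P] and the derivation ['X],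
    so every axiom passes through [f] and [g]. *)
Lemma conformal_sesquilinear_comp {U' V' : lmodType {poly K}}
    (f : {linear U' -> U}) (g : {linear V' -> V}) :
  conformal_sesquilinear (fun u v => op (f u) (g v)).
Proof.
by case: hop => addl addr scall scalr derl derr; split=> *;
  rewrite ?linearD ?linearZ /=.
Qed.

End Sesquilinear.

Theorem theorem4p10 (R : realType) (A M : lmodType {poly R[i]})
    (mul : A -> A -> lpoly A)
    (l : A -> M -> lpoly M) (r : M -> A -> lpoly M)
    (phi : A -> A -> lpoly M) (T : {linear M -> A})
    (hA : assoc_conformal mul)
    (hM : conformal_bimodule mul l r)
    (hphi : conformal_2cocycle mul l r phi)
    (hT : twisted_RotaBaxter mul l r phi T) :
  conformal_NS (fun m n : M => l (T m) n)
               (fun m n : M => r m (T n))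
               (fun m n : M => phi (T m) (T n)).
Proof.
have [sl sr left right mid] := hM; have [sphi coc] := hphi.
have T0 : T 0 = 0 by exact: linear0.
split=> [|||x y z|x y z|x y z|x y z].
- exact: (conformal_sesquilinear_comp sl T idfun).
- exact: (conformal_sesquilinear_comp sr idfun T).
- exact: (conformal_sesquilinear_comp sphi T T).
(* Read backwards, the lemma moves [T] from the operation onto the total product, where [hT] turns
   it into [mul (T x) (T y)]. *)
- by rewrite -(lambda_plus_mu_coefmap T0 l) ?(csesq0l sl) // -hT left.
- by rewrite -(lambda_mu_coefmap T0 r) ?(csesq0r sr) // -hT -right.
- by rewrite -[LHS]/(lambda_mu l (T x) (r y (T z))) -mid.
(* Only the argument of [phi] that receives the polynomial gives up its [T]; the other keeps it
   inside the operation. *)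
- rewrite -(lambda_plus_mu_coefmap T0 (fun a m => phi a (T m)))
    ?(csesq0l sphi) // -hT.
  rewrite -(lambda_mu_coefmap T0 (fun m a => phi (T m) a))
    ?(csesq0r sphi) // -hT.
  (* With all terms on one side, the order of summands and signs is exactly that of [ccoc_eq]. *)
  apply/eqP; rewrite -subr_eq0 opprB addrA.
  by apply/eqP; exact: (coc (T x) (T y) (T z)).
Qed.
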